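(* Let $K$ be a finite set with $|K|\ge2$ and $C,C',D$ nonempty countable sets. Let $u\in\Delta(K\times(C\times C')\times D)$ and $v=\mathrm{marg}_{K\times C\times D}u$. Suppose that the information in $u$ is conditionally independent, i.e. under $u$ the signals $(c,c')$ and $d$ are conditionally independent given $k$. Then $d(u,v)=d_1(u,v)$.
   Context: An information structure is a probability on triples (state $k\in K$, signal of player 1, signal of player 2) with countably many signals; player 1 is the maximizer, player 2 the minimizer. In $u$ the signal of player 1 is $(c,c')$ and that of player 2 is $d$; in $v$ they are $c$ and $d$. A payoff function is a map $g:K\times I\times J\to[-1,1]$ with $I,J$ finite nonempty sets; $\mathcal G$ is the set of all payoff functions and $\mathcal G_1\subset\mathcal G$ is the set of those for which $J$ is a singleton. $\mathrm{val}(u,g)$ is the value of the zero-sum Bayesian game in which the state and signals are drawn from $u$, each player learns his own signal, they simultaneously choose $i\in I$, $j\in J$ (mixed actions depending on own signal allowed), and player 1 receives $g(k,i,j)$ from player 2. $d(u,v)=\sup_{g\in\mathcal G}|\mathrm{val}(u,g)-\mathrm{val}(v,g)|$ and $d_1(u,v)=\sup_{g\in\mathcal G_1}|\mathrm{val}(u,g)-\mathrm{val}(v,g)|$. $\mathrm{marg}$ denotes marginal distributions. *)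

(* Defs.v *)
From HB Require Import structures.
From mathcomp Require Import all_boot all_order all_algebra.
From mathcomp Require Import all_classical all_reals all_analysis.

Set Implicit Arguments.
Unset Strict Implicit.
Unset Printing Implicit Defensive.

Import Order.TTheory GRing.Theory Num.Theory.

Local Open Scope classical_set_scope.
Local Open Scope ring_scope.

(* [\esum] is a supremum of finite partial sums, hence a genuine sum only for
   nonnegative terms. *)
Record distr (R : realType) (T : countType) := Distr {
  mass :> T -> R;
  mass_ge0 : forall x, 0 <= mass x;
  mass_sum1 : \esum_(x in [set: T]) (mass x)%:E = 1%:E }.

Section Pushforward.
Context (R : realType) (T U : countType) (f : T -> U) (p : distr R T).

Definition push_mass (y : U) : R :=
  fine (\esum_(x in f @^-1` [set y]) (p x)%:E).

Lemma push_mass_ge0 y : 0 <= push_mass y.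
Proof. by apply/fine_ge0/esum_ge0 => x _; rewrite lee_fin mass_ge0. Qed.

Lemma push_massE y : (push_mass y)%:E = \esum_(x in f @^-1` [set y]) (p x)%:E.
Proof.
have p0 x : (0 <= (p x)%:E)%E by rewrite lee_fin mass_ge0.
have h0 : (0 <= \esum_(x in f @^-1` [set y]) (p x)%:E)%E by exact: esum_ge0.
have h1 : (\esum_(x in f @^-1` [set y]) (p x)%:E <= 1%:E)%E.
  rewrite -(mass_sum1 p) esum_mkcond; apply: le_esum => x _.
  by case: ifP.
rewrite /push_mass fineK // ge0_fin_numE //.
exact: le_lt_trans h1 (ltry _).
Qed.

Lemma push_mass_sum1 : \esum_(y in [set: U]) (push_mass y)%:E = 1%:E.
Proof.
under eq_esum do rewrite push_massE.
rewrite esum_esum; last by move=> *; rewrite lee_fin mass_ge0.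
rewrite -(mass_sum1 p); symmetry.
rewrite (@reindex_esum _ _ _ [set: T] _ (fun x => (f x, x))) //.
split=> [x _ //|x y _ _ [] //|[y x] /= [_ /= <-]].
by exists x.
Qed.

(* the law of [f x] for [x] drawn from [p]; marginals are the case where [f] is
   a projection *)
Definition push : distr R U := Distr push_mass_ge0 push_mass_sum1.

End Pushforward.

Definition expect (R : realType) (T : countType) (p : distr R T)
    (f : T -> R) : R :=
  let F := fun x => (p x * f x)%:E in
  fine (\esum_(x in [set: T]) (F^\+)%E x - \esum_(x in [set: T]) (F^\-)%E x).

Definition info_structure (R : realType) (K : finType) (S T : countType) :=
  distr R (K * S * T)%type.

Definition cond_indep (R : realType) (K : finType) (S T : countType)
    (u : info_structure R K S T) : Prop :=
  let uK := push (fun x => x.1.1) u in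
  let uKS := push (fun x => x.1) u in
  let uKT := push (fun x => (x.1.1, x.2)) u in
  forall k s t, 0 < uK k ->
    u (k, s, t) / uK k = (uKS (k, s) / uK k) * (uKT (k, t) / uK k).

Record payoff (R : realType) (K : finType) := Payoff {
  act1 : finType;
  act2 : finType;
  act1_neq0 : (0 < #|act1|)%N;
  act2_neq0 : (0 < #|act2|)%N;
  pay :> K -> act1 -> act2 -> R;
  pay_bound : forall k i j, -1 <= pay k i j <= 1 }.

Definition single_agent (R : realType) (K : finType) (g : payoff R K) : Prop :=
  #|act2 g| = 1%N.

Section Value.
Context (R : realType) (K : finType) (S T : countType).
Context (u : info_structure R K S T) (g : payoff R K).

Definition expected_payoff (sigma : S -> distr R (act1 g))
    (tau : T -> distr R (act2 g)) : R :=
  expect u (fun x => let: (k, s, t) := x in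
    \sum_i \sum_j sigma s i * tau t j * g k i j).

Definition maxmin : R :=
  sup [set inf [set expected_payoff sigma tau | tau in [set: T -> distr R (act2 g)]]
      | sigma in [set: S -> distr R (act1 g)]].

Definition minmax : R :=
  inf [set sup [set expected_payoff sigma tau | sigma in [set: S -> distr R (act1 g)]]
      | tau in [set: T -> distr R (act2 g)]].

Definition is_value (w : R) : Prop := w = maxmin /\ w = minmax.

(* The default 0 would be taken only if [maxmin <> minmax]; these always agree,
   by the minimax theorem (finite action sets, countably many signals). *)
Definition game_value : R := xget 0 [set w | is_value w].

End Value.

(* [G] is a bare predicate: [set (payoff R K)] is ruled out by universe
   constraints of the library. *)
Definition value_dist_on (R : realType) (K : finType) (S T S' T' : countType)
    (G : payoff R K -> Prop)
    (u : info_structure R K S T) (v : info_structure R K S' T') : R :=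
  sup [set x : R | exists2 g : payoff R K, G g & x = `|game_value u g - game_value v g|].

Definition value_dist (R : realType) (K : finType) (S T S' T' : countType)
    (u : info_structure R K S T) (v : info_structure R K S' T') : R :=
  value_dist_on (fun _ => True) u v.

Definition value_dist1 (R : realType) (K : finType) (S T S' T' : countType)
    (u : info_structure R K S T) (v : info_structure R K S' T') : R :=
  value_dist_on (@single_agent R K) u v.

Definition forget_c' (K C C' D : Type) (x : K * (C * C') * D) : K * C * D :=
  let: (k, (c, _), d) := x in (k, c, d).

(* Main.v *)
Require Import Defs.
From mathcomp Require Import all_boot all_order all_algebra.
From mathcomp Require Import all_classical all_reals all_analysis.
From mathcomp Require Import ring lra.

(** Write [val(u,g)] for the value of the game.  Since single-agent payoffs are
payoffs, only [d <= d_1] needs an idea.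

Player 1 can ignore [c'], so [val(v,g) <= val(u,g)] ([forget_value_le]) and it
is enough to bound [val(u,g) - val(v,g)] from above.  Let [tau] be a nearly
optimal strategy of player 2 in [v].  It is also a strategy in [u], because both
structures give player 2 the signal [d].  Against the fixed [tau], the payoff of
action [i] at [(k,d)] is a function of [k] and [d] alone; as the signals are
independent given [k], player 1 only cares about its conditional expectation
given the state, which is a single-agent payoff [h(k,i)]
([expected_state_payoff]).  Any strategy of player 1 gets the same against
[tau] in [g] as in [h], under [u] as well as under [v], with the same [h].
Hence [val(u,g)] is at most about [val(u,h)], while [val(v,g)] is at least about
[val(v,h)], and the gap for [g] is at most the gap for [h] up to an arbitrarily
small error ([value_gap_single_agent]).

The argument uses that [val] is both the maxmin and the minmax.  This minimax
theorem for countably many signals ([minimax]) is proved by a no-regret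
argument ([no_regret]): player 1 repeatedly plays regret matching, separately at
each signal, against nearly best replies of player 2.  Per-round regret tends to [0]
uniformly in the signal, so the average of the replies caps the payoff of
every strategy of player 1 close to the maxmin.

Both parts rest on the behaviour of expectations on fibres: bounded functions
with the same expectation on every fibre of a map have the same expectation
([expect_fibre_eq]).  The tower property and the reduction by conditional
independence are consequences. *)

Set Implicit Arguments.
Unset Strict Implicit.
Unset Printing Implicit Defensive.

Import Order.TTheory GRing.Theory Num.Theory.

Local Open Scope classical_set_scope.
Local Open Scope ring_scope.

(** * Expectation of bounded functions *)

Section BoundedFunctions.
Context (R : realType) (X : Type).
Implicit Types f g : X -> R.

(** Boundedness is what makes [expect] linear: it keeps the sums of positive and
negative parts finite, so their difference is a genuine expectation. *)
Definition bnd f := exists M, forall x, `|f x| <= M.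

Lemma bnd_cst (c : R) : bnd (fun=> c).
Proof. by exists `|c|. Qed.

Lemma bndD f g : bnd f -> bnd g -> bnd (fun x => f x + g x).
Proof.
move=> [M fM] [N gN]; exists (M + N) => x.
exact: le_trans (ler_normD _ _) (lerD (fM x) (gN x)).
Qed.

Lemma bndM f g : bnd f -> bnd g -> bnd (fun x => f x * g x).
Proof.
move=> [M fM] [N gN]; exists (M * N) => x.
by rewrite normrM ler_pM.
Qed.

Lemma bndN f : bnd f -> bnd (fun x => - f x).
Proof. by move=> [M fM]; exists M => x; rewrite normrN. Qed.

Lemma bndB f g : bnd f -> bnd g -> bnd (fun x => f x - g x).
Proof. by move=> bf bg; apply: bndD => //; exact: bndN. Qed.

Lemma bnd_sum (I : finType) (F : I -> X -> R) :
  (forall i, bnd (F i)) -> bnd (fun x => \sum_i F i x).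
Proof.
move=> bF; elim: (index_enum I) => [|i s IHs].
  by under eq_fun do rewrite big_nil; exact: bnd_cst.
by under eq_fun do rewrite big_cons; exact: bndD.
Qed.

Lemma bnd_fin (I : finType) (F : I -> R) (phi : X -> I) :
  bnd (fun x => F (phi x)).
Proof.
exists (\sum_i `|F i|) => x.
by rewrite (bigD1 (phi x)) //= lerDl sumr_ge0.
Qed.

Lemma bnd_ind (b : X -> bool) : bnd (fun x => (b x)%:R).
Proof. by exists 1 => x; case: (b x); rewrite ?normr1 ?normr0. Qed.

Lemma bnd_pos f : bnd f -> bnd (fun x => Num.max (f x) 0).
Proof.
move=> [M fM]; exists M => x; apply: le_trans (fM x).
by case: (lerP 0 (f x)) => //; rewrite normr0.
Qed.

End BoundedFunctions.

Lemma bnd_comp (R : realType) (X Y : Type) (f : Y -> R) (phi : X -> Y) :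
  bnd f -> bnd (fun x => f (phi x)).
Proof. by move=> [M fM]; exists M => x. Qed.

(** Holds for [c = 0] as well because infinite sums are suprema of finite ones and
[0 * +oo = 0]. *)
Lemma esumZ (R : realType) (X : choiceType) (D : set X) (c : R)
    (a : X -> \bar R) : (0 <= c) -> (forall x, 0 <= a x)%E ->
  (\esum_(x in D) (c%:E * a x) = c%:E * \esum_(x in D) a x)%E.
Proof.
move=> c0 a0; rewrite /esum -ereal_supZl //; last first.
  by apply/set0P; exists 0%E, set0; rewrite ?fsbig_set0 //; exact: fsets_set0.
congr ereal_sup; apply/seteqP; split => [_ [A DA <-]|_ [_ [A DA <-] <-]] /=.
  exists (\sum_(x \in A) a x)%E; first by exists A.
  by rewrite ge0_mule_fsumr.
by exists A => //; rewrite ge0_mule_fsumr.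
Qed.

Section Expectation.
Context (R : realType) (X : countType) (p : distr R X).
Implicit Types f g : X -> R.

Let esum_le f M : (forall x, 0 <= f x <= M) ->
  (\esum_(x in [set: X]) (p x * f x)%:E <= M%:E)%E.
Proof.
move=> fM.
have [X0|/set0P[x _]] := eqVneq [set: X] set0; last first.
  have M0 : 0 <= M by have /andP[f0 ?] := fM x; exact: le_trans f0 _.
  rewrite -[leRHS]mule1 -(mass_sum1 p) -esumZ//; last first.
    by move=> y; rewrite lee_fin mass_ge0.
  apply: le_esum => y _; rewrite -EFinM lee_fin mulrC ler_wpM2r ?mass_ge0//.
  by have /andP[] := fM y.
have := mass_sum1 p; rewrite X0 esum_set0 => /esym/eqP.
by rewrite eqe oner_eq0.
Qed.

Lemma ge0_expect f : (forall x, 0 <= f x) -> bnd f ->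
  (expect p f)%:E = \esum_(x in [set: X]) (p x * f x)%:E.
Proof.
move=> f0 [M fM]; have pf0 x : (0 <= (p x * f x)%:E)%E.
  by rewrite lee_fin mulr_ge0 ?mass_ge0.
rewrite /expect [X in fine (_ - X)](_ : _ = 0%E); last first.
  apply: esum1 => x _.
  by rewrite funenegE; apply/max_idPr; rewrite leeNl oppe0 pf0.
rewrite sube0 (@eq_esum _ _ _ _ (fun x => (p x * f x)%:E)); last first.
  by move=> x _; rewrite funeposE; exact/max_idPl/pf0.
rewrite fineK// ge0_fin_numE; last exact: esum_ge0.
apply: le_lt_trans (ltry M); apply: esum_le => x.
by rewrite f0 /=; exact: le_trans (ler_norm _) (fM x).
Qed.

(** Any two ways of writing a function as a difference of nonnegative summable ones
give the same difference of sums, so [expect] may be computed from [f] and [g]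
instead of the positive and negative parts.  Additivity and homogeneity are
derived from this case. *)
Let expectB_ge0 f g : (forall x, 0 <= f x) -> (forall x, 0 <= g x) ->
  bnd f -> bnd g -> expect p (fun x => f x - g x) = expect p f - expect p g.
Proof.
move=> f0 g0 bf bg.
have pf0 (h : X -> R) x : (forall x, 0 <= h x) -> (0 <= (p x * h x)%:E)%E.
  by move=> h0; rewrite lee_fin mulr_ge0 ?mass_ge0.
have sm (h : X -> R) : (forall x, 0 <= h x) -> bnd h ->
    summable [set: X] (fun x => (p x * h x)%:E).
  move=> h0 bh; rewrite /summable (@eq_esum _ _ _ _ (fun x => (p x * h x)%:E)).
    by rewrite -ge0_expect// ltry.
  by move=> x _; rewrite gee0_abs// pf0.
have FE : (fun x => (p x * (f x - g x))%:E) =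
  ((fun x => (p x * f x)%:E) \- (fun x => (p x * g x)%:E))%E.
  by apply/funext => x /=; rewrite mulrBr EFinB.
rewrite [LHS]/expect FE esumB; try by [exact: sm|move=> *; exact: pf0].
by rewrite -!ge0_expect.
Qed.

Let posneg f : f = fun x => Num.max (f x) 0 - Num.max (- f x) 0.
Proof.
apply/funext => x; case: (lerP 0 (f x)) => h.
  by rewrite (max_idPr _) ?subr0// oppr_le0.
by rewrite (max_idPl _) ?opprK ?add0r// oppr_ge0 ltW.
Qed.

Let max_ge0 (a : R) : 0 <= Num.max a 0.
Proof. by rewrite le_max lexx orbT. Qed.

Let ge0_expectD f g : (forall x, 0 <= f x) -> (forall x, 0 <= g x) ->
  bnd f -> bnd g -> expect p (fun x => f x + g x) = expect p f + expect p g.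
Proof.
move=> f0 g0 bf bg.
have := expectB_ge0 (fun x => addr_ge0 (f0 x) (g0 x)) g0 (bndD bf bg) bg.
under eq_fun do rewrite addrK.
by move=> ->; rewrite subrK.
Qed.

Lemma expectD f g : bnd f -> bnd g ->
  expect p (fun x => f x + g x) = expect p f + expect p g.
Proof.
move=> bf bg; have [bf' bg'] := (bndN bf, bndN bg).
have bp := @bnd_pos R X.
rewrite [in RHS](posneg f) [in RHS](posneg g).
rewrite !expectB_ge0//; try exact: bp; try exact: max_ge0.
rewrite addrACA -opprD -!ge0_expectD//; try exact: bp; try exact: max_ge0.
rewrite -expectB_ge0//; try by move=> x; apply: addr_ge0; exact: max_ge0.
- congr expect; apply/funext => x.
  by rewrite {1}(posneg f) {1}(posneg g); ring.
- by apply: bndD; exact: bp.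
- by apply: bndD; exact: bp.
Qed.

Lemma expectB f g : bnd f -> bnd g ->
  expect p (fun x => f x - g x) = expect p f - expect p g.
Proof.
move=> bf bg; have := expectD (bndB bf bg) bg.
by under eq_fun do rewrite subrK; move=> ->; rewrite addrK.
Qed.

Lemma expect0 : expect p (fun=> 0) = 0.
Proof.
have := expectB (bnd_cst X 0) (bnd_cst X 0).
by under eq_fun do rewrite subrr; rewrite subrr.
Qed.

Lemma expectN f : bnd f -> expect p (fun x => - f x) = - expect p f.
Proof.
move=> bf; have := expectB (bnd_cst X 0) bf.
by under eq_fun do rewrite sub0r; rewrite expect0 sub0r.
Qed.

Let ge0_expectZ c f : 0 <= c -> (forall x, 0 <= f x) -> bnd f ->
  expect p (fun x => c * f x) = c * expect p f.
Proof.
move=> c0 f0 bf; apply: EFin_inj; rewrite EFinM !ge0_expect//.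
- rewrite -esumZ//; last by move=> x; rewrite lee_fin mulr_ge0 ?mass_ge0.
  by apply: eq_esum => x _; rewrite -EFinM mulrCA.
- by move=> x; exact: mulr_ge0.
- by apply: bndM => //; exact: bnd_cst.
Qed.

Lemma expectZ c f : bnd f -> expect p (fun x => c * f x) = c * expect p f.
Proof.
move=> bf.
have Zge0 d (g : X -> R) : 0 <= d -> bnd g ->
      expect p (fun x => d * g x) = d * expect p g.
  move=> d0 bg; have bN := bndN bg; have bp := @bnd_pos R X.
  have bdp (h : X -> R) : bnd h -> bnd (fun x => d * Num.max (h x) 0).
    by move=> bh; apply: bndM; [exact: bnd_cst|exact: bp].
  rewrite [in RHS](posneg g) expectB; try exact: bp.
  rewrite mulrBr -!ge0_expectZ//; try exact: bp; try exact: max_ge0.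
  rewrite -expectB; try exact: bdp.
  by congr expect; apply/funext => x; rewrite {1}(posneg g) mulrBr.
have [c0|/ltW c0] := lerP 0 c; first exact: Zge0.
rewrite -[in RHS](opprK c) mulNr -Zge0 ?oppr_ge0// -expectN.
  by congr expect; apply/funext => x; rewrite mulNr opprK.
by apply: bndM => //; exact: bnd_cst.
Qed.

Lemma expect_cst c : expect p (fun=> c) = c.
Proof.
have -> : (fun=> c) = (fun _ : X => c * 1) by apply/funext => x; rewrite mulr1.
rewrite expectZ; last exact: bnd_cst.
rewrite [X in c * X](_ : _ = 1) ?mulr1//; apply: EFin_inj.
rewrite ge0_expect//; last exact: bnd_cst.
by rewrite -(mass_sum1 p); apply: eq_esum => x _; rewrite mulr1.
Qed.

Lemma expect_sum (I : finType) (F : I -> X -> R) : (forall i, bnd (F i)) ->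
  expect p (fun x => \sum_i F i x) = \sum_i expect p (F i).
Proof.
move=> bF.
suff [_ ->] : bnd (fun x => \sum_i F i x) /\
  expect p (fun x => \sum_i F i x) = \sum_i expect p (F i) by [].
elim: (index_enum I) => [|i s [bs IHs]].
  rewrite big_nil; under eq_fun do rewrite big_nil.
  by split; [exact: bnd_cst|exact: expect0].
rewrite big_cons; under eq_fun do rewrite big_cons.
by split; [exact: bndD|rewrite expectD// IHs].
Qed.

Lemma le_expect f g : bnd f -> bnd g -> (forall x, f x <= g x) ->
  expect p f <= expect p g.
Proof.
move=> bf bg fg; rewrite -subr_ge0 -expectB// -lee_fin ge0_expect.
- by apply: esum_ge0 => x _; rewrite lee_fin mulr_ge0 ?mass_ge0 ?subr_ge0.
- by move=> x; rewrite subr_ge0.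
- exact: bndB.
Qed.

End Expectation.

Section Fibres.
Context (R : realType) (X Y : countType) (p : distr R X) (phi : X -> Y).
Implicit Types f g : X -> R.

Let bnd_fib f y : bnd f -> bnd (fun x => (phi x == y)%:R * f x).
Proof. by move=> bf; apply: bndM => //; exact: bnd_ind. Qed.

Let fib_ge0 f y : (forall x, 0 <= f x) ->
  forall x, 0 <= (phi x == y)%:R * f x.
Proof. by move=> f0 x; rewrite mulr_ge0. Qed.

Let esum_fib f y : (forall x, 0 <= f x) -> bnd f ->
  \esum_(x in phi @^-1` [set y]) (p x * f x)%:E =
  (expect p (fun x => (phi x == y)%:R * f x))%:E.
Proof.
move=> f0 bf; rewrite ge0_expect//; [|exact: fib_ge0|exact: bnd_fib].
rewrite esum_mkcond; apply: eq_esum => x _.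
have -> : (x \in phi @^-1` [set y]) = (phi x == y).
  by apply/idP/eqP; rewrite inE.
by case: eqP; rewrite ?mul1r// mul0r mulr0.
Qed.

Let esum_expect_fib f : (forall x, 0 <= f x) -> bnd f ->
  (expect p f)%:E = \esum_(y in [set: Y])
    (expect p (fun x => (phi x == y)%:R * f x))%:E.
Proof.
move=> f0 bf; under eq_esum do rewrite -esum_fib//.
rewrite esum_esum; last by move=> *; rewrite lee_fin mulr_ge0 ?mass_ge0.
rewrite ge0_expect// (@reindex_esum _ _ _ [set: X] _ (fun x => (phi x, x)))//.
split=> [x _ //|x y _ _ [] //|[y x] /= [_ /= <-]].
by exists x.
Qed.

Lemma push_expect y : push phi p y = expect p (fun x => (phi x == y)%:R).
Proof.
apply: EFin_inj; have := @esum_fib (fun=> 1) y (fun=> ler01) (bnd_cst _ 1).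
under [in RHS]eq_fun do rewrite mulr1.
move=> <-; rewrite [LHS]push_massE; apply: eq_esum => x _.
by rewrite mulr1.
Qed.

(** Countable additivity over the fibres of [phi].  Adding a constant makes both
functions nonnegative, where the sums over fibres can be regrouped freely. *)
Lemma expect_fibre_eq f g : bnd f -> bnd g ->
  (forall y, expect p (fun x => (phi x == y)%:R * f x) =
             expect p (fun x => (phi x == y)%:R * g x)) ->
  expect p f = expect p g.
Proof.
move=> [M fM] [N gN] fg.
have [bf bg] : bnd f /\ bnd g by split; [exists M|exists N].
pose c := `|M| + `|N|.
have fc0 x : 0 <= f x + c.
  have := fM x; have := ler_norm (- f x); have := ler_norm M.
  rewrite normrN /c; have := normr_ge0 N; lra.
have gc0 x : 0 <= g x + c.
  have := gN x; have := ler_norm (- g x); have := ler_norm N.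
  rewrite normrN /c; have := normr_ge0 M; lra.
have bc (h : X -> R) : bnd h -> bnd (fun x => h x + c).
  by move=> bh; apply: bndD => //; exact: bnd_cst.
apply: (@addIr _ c); rewrite -[X in _ + X](expect_cst p c).
rewrite -[X in _ = _ + X](expect_cst p c).
rewrite -!expectD//; try exact: bnd_cst.
apply: EFin_inj; rewrite !esum_expect_fib//; try exact: bc.
apply: eq_esum => y _; congr _%:E.
have bcy : bnd (fun x => (phi x == y)%:R * c) by apply: bnd_fib; exact: bnd_cst.
under eq_fun do rewrite mulrDr.
under [in RHS]eq_fun do rewrite mulrDr.
by rewrite !expectD ?fg//; exact: bnd_fib.
Qed.

Lemma expect_push (h : Y -> R) : bnd h ->
  expect (push phi p) h = expect p (fun x => h (phi x)).
Proof.
move=> bh; suff ge0 (g : Y -> R) : (forall y, 0 <= g y) -> bnd g ->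
    expect (push phi p) g = expect p (fun x => g (phi x)).
  case: (bh) => M hM.
  have hM0 y : 0 <= h y + M.
    by have := hM y; have := ler_norm (- h y); rewrite normrN; lra.
  have bhM : bnd (fun y => h y + M) by apply: bndD => //; exact: bnd_cst.
  have := ge0 _ hM0 bhM; rewrite !expectD//; try exact: bnd_cst.
    by rewrite !expect_cst => /addIr.
  exact: bnd_comp.
move=> g0 bg; apply: EFin_inj; rewrite ge0_expect// esum_expect_fib//.
  apply: eq_esum => y _; congr _%:E; rewrite push_expect mulrC -expectZ.
    congr expect; apply/funext => x.
    by case: eqP => [->|]; rewrite ?mulr0 ?mul0r// mulr1 mul1r.
  exact: bnd_ind.
exact: bnd_comp.
Qed.

End Fibres.

Lemma expect_point (R : realType) (X : countType) (p : distr R X) (a : X) :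
  expect p (fun x => (x == a)%:R) = p a.
Proof.
rewrite -push_expect; apply: EFin_inj; rewrite [LHS]push_massE.
rewrite (_ : _ @^-1` _ = [set a]) ?esum_set1 ?lee_fin ?mass_ge0//.
Qed.

(** * Conditional expectation and conditional independence *)

Section ConditionalExpectation.
Context (R : realType) (X Y : countType) (p : distr R X) (phi : X -> Y).

(** At a point [y] of mass zero this is [0], by the convention on division; so the
bound of [f] still bounds [condE f] everywhere. *)
Definition condE (f : X -> R) (y : Y) : R :=
  expect p (fun x => (phi x == y)%:R * f x) / push phi p y.

Lemma fibre_bound f M y : (forall x, `|f x| <= M) ->
  `|expect p (fun x => (phi x == y)%:R * f x)| <= M * push phi p y.
Proof.
move=> fM; have bf : bnd f by exists M.
have b1 : bnd (fun x => (phi x == y)%:R : R) := bnd_ind R (fun x => phi x == y).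
rewrite push_expect -expectZ// ler_norml -mulN1r -expectZ; last first.
  by apply: bndM => //; exact: bnd_cst.
have bM : bnd (fun x => M * (phi x == y)%:R).
  by apply: bndM => //; exact: bnd_cst.
apply/andP; split; apply: le_expect; try by [exact: bndM|];
  try (by apply: bndM => //; exact: bnd_cst); move=> x; have := fM x;
  rewrite ler_norml => /andP[]; case: (phi x == y) => /=; lra.
Qed.

Lemma condE_fibre f y : bnd f ->
  expect p (fun x => (phi x == y)%:R * f x) = condE f y * push phi p y.
Proof.
move=> [M fM]; rewrite /condE.
have [p0|p0] := eqVneq (push phi p y) 0; last by rewrite divfK.
rewrite p0 mulr0; apply/eqP; rewrite -normr_le0.
by apply: le_trans (fibre_bound y fM) _; rewrite p0 mulr0.
Qed.

Lemma condE_bound f M y : 0 <= M -> (forall x, `|f x| <= M) ->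
  `|condE f y| <= M.
Proof.
move=> M0 fM; have := fibre_bound y fM; rewrite /condE.
have := mass_ge0 (push phi p) y; rewrite le_eqVlt => /predU1P[<- _|p0].
  by rewrite invr0 mulr0 normr0.
by rewrite normrM normfV (gtr0_norm p0) ler_pdivrMr.
Qed.

Lemma bnd_condE f : bnd f -> bnd (condE f).
Proof.
move=> [M fM]; exists `|M| => y; apply: condE_bound => // x.
exact: le_trans (fM x) (ler_norm M).
Qed.

Lemma expect_fibreZ (a : Y -> R) f y : bnd f ->
  expect p (fun x => (phi x == y)%:R * (a (phi x) * f x)) =
  a y * expect p (fun x => (phi x == y)%:R * f x).
Proof.
move=> bf; rewrite -expectZ; last by apply: bndM => //; exact: bnd_ind.
congr expect; apply/funext => x.
by case: eqP => [->|_]; rewrite ?mul0r ?mulr0// !mul1r.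
Qed.

(** On each fibre of [phi] the factor [a] is constant, and there [f] and its
conditional expectation have the same expectation. *)
Lemma tower (a : Y -> R) f : bnd a -> bnd f ->
  expect p (fun x => a (phi x) * f x) =
  expect p (fun x => a (phi x) * condE f (phi x)).
Proof.
move=> ba bf; have [bap bc] := (bnd_comp phi ba, bnd_comp phi (bnd_condE bf)).
apply: (@expect_fibre_eq _ _ _ _ phi); try exact: bndM.
move=> y; rewrite !expect_fibreZ//; congr (_ * _).
rewrite condE_fibre// push_expect -expectZ; last exact: bnd_ind.
congr expect; apply/funext => x.
by case: eqP => [->|_]; rewrite ?mul0r ?mulr0// mulr1 mul1r.
Qed.

End ConditionalExpectation.

Section ConditionalIndependence.
Context (R : realType) (K : finType) (S T : countType).
Context (u : info_structure R K S T) (u_ci : cond_indep u).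

Lemma push_state_signal0 k s :
  push (fun x => x.1.1) u k = 0 -> push (fun x => x.1) u (k, s) = 0.
Proof.
move=> k0; apply/eqP; rewrite eq_le mass_ge0 andbT -k0 !push_expect.
apply: le_expect; [exact: bnd_ind|exact: bnd_ind|move=> [[k' s'] t'] /=].
by rewrite ler_nat xpair_eqE; do 2!case: eqP.
Qed.

(** The product form of conditional independence makes sense at states of
probability zero too: both sides vanish there. *)
Lemma cond_indepM k s t :
  push (fun x => x.1.1) u k * u (k, s, t) =
  push (fun x => x.1) u (k, s) * push (fun x => (x.1.1, x.2)) u (k, t).
Proof.
have [k0|k0] := eqVneq (push (fun x => x.1.1) u k) 0; last first.
  have kgt0 : 0 < push (fun x => x.1.1) u k.
    by rewrite lt_neqAle eq_sym k0 mass_ge0.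
  have := u_ci s t kgt0; move: k0; set a := push _ _ _ => a0.
  by move=> /(congr1 ( *%R^~ a)); rewrite divfK// => ->; field.
by rewrite push_state_signal0// k0 !mul0r.
Qed.

(** Given the state, the signal of player 1 carries no information about that of
player 2.  On the fibre of [(k, s)] the claim says that [f] has the same
conditional expectation given [(k, s)] as given [k]; this is checked on the
fibres of the second signal, where it is the product formula. *)
Lemma cond_indep_expect (a : K * S -> R) (f : K * T -> R) : bnd a -> bnd f ->
  expect u (fun x => a x.1 * f (x.1.1, x.2)) =
  expect u (fun x => a x.1 *
    condE u (fun y => y.1.1) (fun y => f (y.1.1, y.2)) x.1.1).
Proof.
move=> ba bf; set h := condE _ _ _.
have bF : bnd (fun x : K * S * T => f (x.1.1, x.2)) by exact: bnd_comp.
have bh : bnd (fun x : K * S * T => h x.1.1) by exact: bnd_fin.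
have ba1 : bnd (fun x : K * S * T => a x.1) by exact: bnd_comp.
apply: (@expect_fibre_eq _ _ _ _ (fun x => x.1)); try exact: bndM.
move=> [k s]; rewrite !(@expect_fibreZ _ _ _ u (fun x => x.1))//; congr (_ * _).
transitivity (h k * push (fun x => x.1) u (k, s)); last first.
  rewrite push_expect -expectZ; last exact: bnd_ind.
  congr expect; apply/funext => -[[k' s'] t'] /=.
  by case: eqP => [[-> _]|_]; rewrite ?mul0r ?mulr0// mulr1 mul1r.
have [k0|k0] := eqVneq (push (fun x => x.1.1) u k) 0.
  have ks0 := push_state_signal0 s k0.
  by rewrite (condE_fibre u (fun x => x.1))// ks0 !mulr0.
apply: (mulfI k0); rewrite mulrA [_ * h k]mulrC -condE_fibre//.
have bfib (b : K * S * T -> bool) c :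
    bnd (fun x : K * S * T => c * ((b x)%:R * f (x.1.1, x.2))).
  by do 2?apply: bndM => //; [exact: bnd_cst|exact: bnd_ind].
have bfib1 (b : K * S * T -> bool) :
    bnd (fun x : K * S * T => (b x)%:R * f (x.1.1, x.2)).
  by apply: bndM => //; exact: bnd_ind.
rewrite [RHS]mulrC -!expectZ//.
apply: (@expect_fibre_eq _ _ _ _ (fun x => x.2)) => // t.
transitivity (f (k, t) * (push (fun x => x.1.1) u k * u (k, s, t))).
  rewrite -(expect_point u (k, s, t)) mulrA -expectZ; last exact: bnd_ind.
  congr expect; apply/funext => -[[k' s'] t'] /=; rewrite !xpair_eqE.
  by do 3![case: eqP => [?|_]]; subst => /=; ring.
rewrite cond_indepM [push (fun x => (x.1.1, x.2)) u _]push_expect.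
rewrite mulrA -expectZ; last exact: bnd_ind.
congr expect; apply/funext => -[[k' s'] t'] /=; rewrite xpair_eqE.
by do 2![case: eqP => [?|_]]; subst => /=; ring.
Qed.
End ConditionalIndependence.

(** * Mixed actions and regret matching *)

Section FiniteDistributions.
Context (R : realType) (I : finType).
Implicit Types p q : distr R I.

Let esum_finType (f : I -> R) : (forall i, 0 <= f i) ->
  \esum_(i in [set: I]) (f i)%:E = (\sum_i f i)%:E.
Proof.
move=> f0; rewrite esum_fset; last by move=> i _; rewrite lee_fin.
  rewrite (_ : [set: I] = [set` index_enum I]); last first.
    by apply/seteqP; split => x //= _; rewrite mem_index_enum.
  by rewrite -fsbig_seq ?index_enum_uniq// sumEFin.
exact: finite_finset.
Qed.

Lemma distr_sum1 p : \sum_i p i = 1.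
Proof.
apply: EFin_inj; rewrite -esum_finType ?mass_sum1// => i; exact: mass_ge0.
Qed.

Lemma distr_le1 p i : p i <= 1.
Proof.
rewrite -(distr_sum1 p) (bigD1 i) //= lerDl sumr_ge0// => j _; exact: mass_ge0.
Qed.

Lemma distr_avg_le p (f : I -> R) M :
  (forall i, `|f i| <= M) -> `|\sum_i p i * f i| <= M.
Proof.
move=> fM; apply: le_trans (ler_norm_sum _ _ _) _.
rewrite -[leRHS]mul1r -(distr_sum1 p) mulr_suml; apply: ler_sum => i _.
by rewrite normrM ger0_norm ?mass_ge0// ler_wpM2l ?mass_ge0.
Qed.

Lemma fin_distr_subproof (f : I -> R) : (forall i, 0 <= f i) -> \sum_i f i = 1 ->
  \esum_(i in [set: I]) (f i)%:E = 1%:E.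
Proof. by move=> f0 f1; rewrite esum_finType// f1. Qed.

Definition fin_distr (f : I -> R) (f0 : forall i, 0 <= f i)
  (f1 : \sum_i f i = 1) : distr R I := Distr f0 (fin_distr_subproof f0 f1).

Lemma distr_inhabited : (0 < #|I|)%N -> inhabited (distr R I).
Proof.
move=> /card_gt0P[i0 _].
have h0 i : 0 <= (i == i0)%:R :> R by [].
have h1 : \sum_i (i == i0)%:R = 1 :> R.
  by rewrite (bigD1 i0)//= eqxx big1 ?addr0// => i /negPf->.
exact: (inhabits (fin_distr h0 h1)).
Qed.

Lemma mix_distr (w : R) p q : 0 <= w <= 1 ->
  exists m : distr R I, forall i, m i = w * p i + (1 - w) * q i.
Proof.
move=> /andP[w0 w1].
have h0 i : 0 <= w * p i + (1 - w) * q i.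
  by rewrite addr_ge0// mulr_ge0 ?mass_ge0// subr_ge0.
have h1 : \sum_i (w * p i + (1 - w) * q i) = 1.
  by rewrite big_split /= -!mulr_sumr !distr_sum1; ring.
by exists (fin_distr h0 h1).
Qed.

(** Playing actions with probabilities proportional to the positive parts of their
cumulative regrets [r] makes the next regret vector orthogonal to the positive
part of [r], whatever the payoffs [x] turn out to be.  If no regret is positive,
any mixed action does. *)
Lemma regret_matching (r : I -> R) : (0 < #|I|)%N ->
  exists p : distr R I, forall x : I -> R,
    \sum_i Num.max (r i) 0 * (x i - \sum_j p j * x j) = 0.
Proof.
move=> /distr_inhabited[d].
have max0 i : 0 <= Num.max (r i) 0 by rewrite le_max lexx orbT.
pose W := \sum_i Num.max (r i) 0.
have [W0|W0] := eqVneq W 0.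
  exists d => x; apply: big1 => i _.
  have /eqP := W0; rewrite psumr_eq0// => /allP/(_ i (mem_index_enum i)) /= /eqP->.
  by rewrite mul0r.
have h0 i : 0 <= Num.max (r i) 0 / W by rewrite divr_ge0// sumr_ge0.
have h1 : \sum_i Num.max (r i) 0 / W = 1 by rewrite -mulr_suml divff.
exists (fin_distr h0 h1) => x /=.
under eq_bigr do rewrite mulrBr.
rewrite sumrB -mulr_suml -/W mulr_sumr; apply/eqP; rewrite subr_eq0; apply/eqP.
by apply: eq_bigr => i _; field.
Qed.

End FiniteDistributions.

(** Expansion of the square of a positive part, for the growth of the regret
potential: the middle term disappears under regret matching. *)
Lemma sqr_posD (R : realDomainType) (a b : R) :
  Num.max (a + b) 0 ^+ 2 <= Num.max a 0 ^+ 2 + 2 * (Num.max a 0 * b) + b ^+ 2.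
Proof.
case: (lerP a 0) => a0; case: (lerP (a + b) 0) => ab0; rewrite ?expr2; nra.
Qed.

(** * No-regret play in Bayesian games *)

Section Minimax.
Context (R : realType) (K : finType) (S T : countType).
Context (u : info_structure R K S T) (g : payoff R K).
Notation L := (expected_payoff u (g := g)).
Implicit Types (sigma : S -> distr R (act1 g)) (tau : T -> distr R (act2 g)).

Definition reply_payoff tau (i : act1 g) (k : K) (t : T) : R :=
  \sum_j tau t j * g k i j.

Lemma reply_payoff_bound tau i k t : `|reply_payoff tau i k t| <= 1.
Proof. by apply: distr_avg_le => j; rewrite ler_norml pay_bound. Qed.

Lemma bnd_reply tau i :
  bnd (fun x : K * S * T => reply_payoff tau i x.1.1 x.2).
Proof. by exists 1 => x; exact: reply_payoff_bound. Qed.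

Lemma bnd_strategy (X : Type) (I : finType) (sigma : X -> distr R I) i :
  bnd (fun x => sigma x i).
Proof. by exists 1 => x; rewrite ger0_norm ?mass_ge0 ?distr_le1. Qed.

Lemma expected_payoffE sigma tau : L sigma tau =
  expect u (fun x => \sum_i sigma x.1.2 i * reply_payoff tau i x.1.1 x.2).
Proof.
congr expect; apply/funext => -[[k s] t] /=; apply: eq_bigr => i _.
by rewrite mulr_sumr; apply: eq_bigr => j _; rewrite mulrA.
Qed.

Lemma expected_payoff_bound sigma tau : `|L sigma tau| <= 1.
Proof.
rewrite expected_payoffE.
have h x : `|\sum_i sigma x.1.2 i * reply_payoff tau i x.1.1 x.2| <= 1.
  by apply: distr_avg_le => i; exact: reply_payoff_bound.
have b : bnd (fun x : K * S * T =>
  \sum_i sigma x.1.2 i * reply_payoff tau i x.1.1 x.2) by exists 1.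
rewrite ler_norml -[X in X <= _ <= _](expect_cst u) -[X in _ <= _ <= X](expect_cst u).
by apply/andP; split; apply: le_expect => //; try exact: bnd_cst;
  move=> x; have := h x; rewrite ler_norml => /andP[].
Qed.

Lemma expected_payoff_mix w sigma tau1 tau2 tau :
  (forall t j, tau t j = w * tau1 t j + (1 - w) * tau2 t j) ->
  L sigma tau = w * L sigma tau1 + (1 - w) * L sigma tau2.
Proof.
move=> tauE; rewrite !expected_payoffE.
have b tau' : bnd (fun x : K * S * T =>
    \sum_i sigma x.1.2 i * reply_payoff tau' i x.1.1 x.2).
  apply: bnd_sum => i; apply: bndM; last exact: bnd_reply.
  exact: (bnd_comp (fun x : K * S * T => x.1.2) (bnd_strategy sigma i)).
rewrite -!expectZ// -expectD; try by apply: bndM => //; exact: bnd_cst.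
congr expect; apply/funext => x.
rewrite !mulr_sumr -big_split; apply: eq_bigr => i _ /=.
rewrite /reply_payoff !mulr_sumr -big_split; apply: eq_bigr => j _ /=.
by rewrite tauE; ring.
Qed.

(** Player 1 sees only [s], so regret has to be measured with these interim
payoffs. *)
Definition signal_payoff tau (s : S) (i : act1 g) : R :=
  condE u (fun x => x.1.2) (fun x => reply_payoff tau i x.1.1 x.2) s.

Lemma signal_payoff_bound tau s i : `|signal_payoff tau s i| <= 1.
Proof. by apply: condE_bound => // x; exact: reply_payoff_bound. Qed.

Lemma expected_payoff_signal sigma tau : L sigma tau =
  expect u (fun x => \sum_i sigma x.1.2 i * signal_payoff tau x.1.2 i).
Proof.
rewrite expected_payoffE !expect_sum; last 2 first.
- move=> i; apply: bndM; last first.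
    by exists 1 => x; exact: signal_payoff_bound.
  exact: (bnd_comp (fun x : K * S * T => x.1.2) (bnd_strategy sigma i)).
- move=> i; apply: bndM; last exact: bnd_reply.
  exact: (bnd_comp (fun x : K * S * T => x.1.2) (bnd_strategy sigma i)).
apply: eq_bigr => i _.
apply: (@tower _ _ _ u (fun x => x.1.2) (fun s => sigma s i)).
  exact: bnd_strategy.
exact: bnd_reply.
Qed.

(** State after [n] rounds of play: [r s] is the vector of cumulative regrets at
signal [s], and [tau] the average of the replies of player 2 to the regret
matching strategies.  Each reply keeps the round below [c], so the excess of
[tau] over [c] against any [sigma] is paid for by the regret of not having
played [sigma].  Regret matching lets the sum of squares of positive
regrets grow only linearly, hence regrets only like the square root of [n]. *)
Lemma no_regret c n : (forall sigma, exists tau, L sigma tau <= c) ->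
  exists (r : S -> act1 g -> R) tau,
  [/\ forall s i, `|r s i| <= n%:R * 2,
      forall s, \sum_i Num.max (r s i) 0 ^+ 2 <= n%:R * (4 * #|act1 g|%:R)
    & forall sigma, n%:R * (L sigma tau - c) <=
        expect u (fun x => \sum_i sigma x.1.2 i * r x.1.2 i)].
Proof.
move=> reply; elim: n => [|n [r [tau [rM rpot rL]]]].
  have [d] := distr_inhabited R (act2_neq0 g).
  exists (fun _ _ => 0), (fun=> d); split => [s i|s|sigma].
  - by rewrite normr0 mul0r.
  - by rewrite mul0r big1// => i _; rewrite maxxx expr0n.
  - rewrite mul0r (_ : (fun x => _) = fun=> 0) ?expect_cst//.
    by apply/funext => x; rewrite big1// => i _; rewrite mulr0.
pose sg s := sval (cid (regret_matching (r s) (act1_neq0 g))).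
have sgE s x : \sum_i Num.max (r s i) 0 * (x i - \sum_j sg s j * x j) = 0.
  exact: (svalP (cid (regret_matching (r s) (act1_neq0 g)))).
have [tau1 tau1c] := reply sg.
pose y := signal_payoff tau1.
pose rho s i := y s i - \sum_j sg s j * y s j.
have rho2 s i : `|rho s i| <= 2.
  apply: le_trans (ler_normB _ _) _; rewrite (_ : 2 = 1 + 1)//.
  apply: lerD; first exact: signal_payoff_bound.
  by apply: distr_avg_le => j; exact: signal_payoff_bound.
(* weight of the new reply in the running average of [n.+1] replies *)
pose w : R := n.+1%:R^-1.
have w01 : 0 <= w <= 1.
  by rewrite /w invr_ge0 ler0n invf_le1 ?ltr0n// ler1n.
have /choice[tau2 tau2E] : forall t, exists m : distr R (act2 g), forall j,
    m j = w * tau1 t j + (1 - w) * tau t j.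
  by move=> t; exact: mix_distr.
exists (fun s i => r s i + rho s i), tau2; split => [s i|s|sigma].
- rewrite -(natr1 n) mulrDl mul1r.
  exact: le_trans (ler_normD _ _) (lerD (rM s i) (rho2 s i)).
- apply: le_trans (ler_sum _ (fun i _ => sqr_posD (r s i) (rho s i))) _.
  rewrite !big_split /= -mulr_sumr sgE mulr0 addr0 -(natr1 n) mulrDl.
  apply: lerD; first exact: rpot.
  rewrite mul1r -sum1_card natr_sum mulr_sumr; apply: ler_sum => i _.
  have := rho2 s i; rewrite ler_norml => /andP[]; rewrite expr2; nra.
- have br : bnd (fun x : K * S * T => \sum_i sigma x.1.2 i * r x.1.2 i).
    by exists (n%:R * 2) => x /=; apply: distr_avg_le => i; exact: rM.
  have by_ (sg' : S -> distr R (act1 g)) :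
      bnd (fun x : K * S * T => \sum_i sg' x.1.2 i * y x.1.2 i).
    by exists 1 => x /=; apply: distr_avg_le => i; exact: signal_payoff_bound.
  have -> : (fun x : K * S * T =>
      \sum_i sigma x.1.2 i * (r x.1.2 i + rho x.1.2 i)) =
    (fun x => \sum_i sigma x.1.2 i * r x.1.2 i +
      (\sum_i sigma x.1.2 i * y x.1.2 i - \sum_i sg x.1.2 i * y x.1.2 i)).
    apply/funext => x; under eq_bigr do rewrite mulrDr /rho mulrBr.
    by rewrite !big_split /= sumrN -mulr_suml distr_sum1 mul1r.
  rewrite expectD ?expectB//; last exact: bndB.
  rewrite -!expected_payoff_signal (expected_payoff_mix _ tau2E).
  have -> : n.+1%:R * (w * L sigma tau1 + (1 - w) * L sigma tau - c) =
      n%:R * (L sigma tau - c) + (L sigma tau1 - c).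
    have nE : n%:R = n.+1%:R - 1 :> R by rewrite -(natr1 n) addrK.
    rewrite nE /w; field.
    by rewrite nat1r pnatr_eq0.
  by apply: lerD; [exact: rL|rewrite lerD2l lerN2].
Qed.

(** If player 2 can answer every strategy with a payoff of at most [c], a single
strategy nearly guarantees [c]. *)
Lemma minimax_eps c : (forall sigma, exists tau, L sigma tau <= c) ->
  forall eps, 0 < eps -> exists tau, forall sigma, L sigma tau <= c + eps.
Proof.
move=> reply eps eps0.
(* enough rounds for which regrets of size [sqrt (4 #|act1 g| n)] are at most
   [n * eps] *)
pose n := (Num.truncn (4 * #|act1 g|%:R / eps ^+ 2)).+1.
have nP : 4 * #|act1 g|%:R <= n%:R * eps ^+ 2.
  rewrite -ler_pdivrMr ?exprn_gt0//; apply/ltW.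
  exact: truncnS_gt.
have [r [tau [rM rpot rL]]] := no_regret n reply.
have n0 : 0 < n%:R :> R by rewrite ltr0n.
exists tau => sigma; rewrite -lerBlDl -(ler_pM2l n0).
apply: le_trans (rL sigma) _; rewrite -[leRHS](expect_cst u).
have bl : bnd (fun x : K * S * T => \sum_i sigma x.1.2 i * r x.1.2 i).
  by exists (n%:R * 2) => x /=; apply: distr_avg_le => i; exact: rM.
apply: le_expect => //; first exact: bnd_cst.
move=> x; set s := x.1.2.
have rle i : r s i <= n%:R * eps.
  have ne0 : 0 <= n%:R * eps by rewrite mulr_ge0// ltW.
  suff : Num.max (r s i) 0 <= n%:R * eps by rewrite ge_max => /andP[].
  rewrite -ler_sqr ?nnegrE// ?le_max ?lexx ?orbT//.
  have : Num.max (r s i) 0 ^+ 2 <= \sum_i Num.max (r s i) 0 ^+ 2.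
    by rewrite (bigD1 i)//= lerDl sumr_ge0// => j _; exact: sqr_ge0.
  move=> /le_trans; apply; apply: le_trans (rpot s) _.
  by rewrite exprMn [n%:R ^+ 2]expr2 -mulrA ler_wpM2l// ltW.
rewrite -[leRHS]mul1r -[X in _ <= X * _](distr_sum1 (sigma s)) mulr_suml.
by apply: ler_sum => i _; apply: ler_wpM2l; [exact: mass_ge0|exact: rle].
Qed.

End Minimax.

(** * Existence of the value *)

Section GameValue.
Context (R : realType) (K : finType) (S T : countType).
Context (u : info_structure R K S T) (g : payoff R K).
Notation L := (expected_payoff u (g := g)).
Notation strat1 := (S -> distr R (act1 g)).
Notation strat2 := (T -> distr R (act2 g)).

Let floor1 (sigma : strat1) := inf [set L sigma tau | tau in [set: strat2]].
Let ceil2 (tau : strat2) := sup [set L sigma tau | sigma in [set: strat1]].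

Let s0 : inhabited strat1.
Proof.
by have [d] := distr_inhabited R (act1_neq0 g); exists; exact: (fun=> d).
Qed.

Let t0 : inhabited strat2.
Proof.
by have [d] := distr_inhabited R (act2_neq0 g); exists; exact: (fun=> d).
Qed.

Let L_ge sigma tau : -1 <= L sigma tau.
Proof.
by have := expected_payoff_bound u sigma tau; rewrite ler_norml => /andP[].
Qed.

Let L_le sigma tau : L sigma tau <= 1.
Proof.
by have := expected_payoff_bound u sigma tau; rewrite ler_norml => /andP[].
Qed.

Let floor1_le sigma tau : floor1 sigma <= L sigma tau.
Proof. by apply: ge_inf; [exists (-1) => _ [t _ <-]|exists tau]. Qed.

Let ceil2_ge sigma tau : L sigma tau <= ceil2 tau.
Proof. by apply: ub_le_sup; [exists 1 => _ [s _ <-]|exists sigma]. Qed.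

Let floors_has_sup : has_sup [set floor1 sigma | sigma in [set: strat1]].
Proof.
have [[s] [t]] := (s0, t0); split; first by exists (floor1 s), s.
by exists 1 => _ [s' _ <-]; exact: le_trans (floor1_le s' t) _.
Qed.

Let ceils_has_inf : has_inf [set ceil2 tau | tau in [set: strat2]].
Proof.
have [[s] [t]] := (s0, t0); split; first by exists (ceil2 t), t.
by exists (-1) => _ [t' _ <-]; exact: le_trans (ceil2_ge s t').
Qed.

Let maxmin_opt eps : 0 < eps ->
  exists sigma, forall tau, maxmin u g - eps <= L sigma tau.
Proof.
move=> eps0; have [_ [s _ <-] /ltW h] := sup_adherent eps0 floors_has_sup.
by exists s => t; exact: le_trans h (floor1_le s t).
Qed.

Let minmax_opt eps : 0 < eps ->
  exists tau, forall sigma, L sigma tau <= minmax u g + eps.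
Proof.
move=> eps0; have [_ [t _ <-] /ltW h] := inf_adherent eps0 ceils_has_inf.
by exists t => s; exact: le_trans (ceil2_ge s t) h.
Qed.

Let maxmin_reply eps : 0 < eps ->
  forall sigma, exists tau, L sigma tau <= maxmin u g + eps.
Proof.
move=> eps0 s; have [t'] := t0.
have h : has_inf [set L s tau | tau in [set: strat2]].
  by split; [exists (L s t'), t'|exists (-1) => _ [t _ <-]].
have [_ [t _ <-] /ltW tP] := inf_adherent eps0 h.
exists t; apply: le_trans tP _; rewrite lerD2r.
by apply: ub_le_sup; [case: floors_has_sup|exists s].
Qed.

(** Every strategy of player 1 has a reply that keeps him near the maxmin, so
[minimax_eps] provides a strategy of player 2 that guarantees it. *)
Theorem minimax : maxmin u g = minmax u g.
Proof.
apply/eqP; rewrite eq_le; apply/andP; split; apply/ler_addgt0Pr => eps eps0.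
  have e2 : 0 < eps / 2 by rewrite divr_gt0.
  have [[s sP] [t tP]] := (maxmin_opt e2, minmax_opt e2).
  by have := sP t; have := tP s; lra.
have e2 : 0 < eps / 2 by rewrite divr_gt0.
have [t tP] := minimax_eps (maxmin_reply e2) e2.
apply: (@le_trans _ _ (ceil2 t)).
  by apply: ge_inf; [case: ceils_has_inf|exists t].
have [s] := s0; apply: ge_sup; first by exists (L s t), s.
by move=> _ [s' _ <-]; have := tP s'; lra.
Qed.

Lemma game_valueE : game_value u g = maxmin u g.
Proof.
by apply: xget_unique => [|w []//]; split => //; exact: minimax.
Qed.

(** Together with [value_opt2], all that is used about values from here on. *)
Lemma value_opt1 eps : 0 < eps ->
  exists sigma, forall tau, game_value u g - eps <= L sigma tau.
Proof. by rewrite game_valueE; exact: maxmin_opt. Qed.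

Lemma value_opt2 eps : 0 < eps ->
  exists tau, forall sigma, L sigma tau <= game_value u g + eps.
Proof. by rewrite game_valueE minimax; exact: minmax_opt. Qed.

Lemma game_value_bound : `|game_value u g| <= 1.
Proof.
rewrite ler_norml; apply/andP; split; apply/ler_addgt0Pr => eps eps0.
  have [s] := s0; have [t /(_ s)] := value_opt2 eps0.
  exact: le_trans (L_ge _ _).
have [t] := t0; have [s /(_ t)] := value_opt1 eps0.
by rewrite lerBlDr => /le_trans; apply; rewrite lerD2r.
Qed.

End GameValue.

(** * Comparison of the two information structures *)

Section ForgettingInformation.
Context (R : realType) (K : finType) (C C' D : countType).
Context (u : info_structure R K (C * C')%type D).
Let v : info_structure R K C D := push (@forget_c' K C C' D) u.

(** Strategies under [v] are the strategies under [u] that ignore [c']; this lets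
every computation take place under [u]. *)
Lemma expected_payoff_forget (g : payoff R K) (sigma : C -> distr R (act1 g))
    (tau : D -> distr R (act2 g)) :
  expected_payoff v sigma tau = expected_payoff u (fun s => sigma s.1) tau.
Proof.
rewrite !expected_payoffE expect_push.
  by congr expect; apply/funext => -[[k [c c']] d].
by exists 1 => x; apply: distr_avg_le => i; exact: reply_payoff_bound.
Qed.

Lemma forget_value_le (g : payoff R K) : game_value v g <= game_value u g.
Proof.
apply/ler_addgt0Pr => eps eps0; have e2 : 0 < eps / 2 by rewrite divr_gt0.
have [s sP] := value_opt1 v g e2; have [t tP] := value_opt2 u g e2.
have := sP t; have := tP (fun x => s x.1); rewrite -expected_payoff_forget; lra.
Qed.

End ForgettingInformation.

Section SingleAgentReduction.
Context (R : realType) (K : finType) (S T : countType).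
Context (u : info_structure R K S T) (u_ci : cond_indep u).
Context (g : payoff R K) (tau : T -> distr R (act2 g)).

Let pay1 (k : K) (i : act1 g) (_ : unit) : R :=
  condE u (fun x => x.1.1) (fun x => reply_payoff tau i x.1.1 x.2) k.

Let pay1_bound k i j : -1 <= pay1 k i j <= 1.
Proof.
rewrite -ler_norml; apply: condE_bound => // x; exact: reply_payoff_bound.
Qed.

Let unit_neq0 : (0 < #|{: unit}|)%N. Proof. by rewrite card_unit. Qed.

(** The single-agent problem that player 1 faces against the fixed strategy [tau]
once the signal of player 2 has been averaged out given the state. *)
Definition state_payoff : payoff R K :=
  Payoff (act1_neq0 g) unit_neq0 pay1_bound.

Lemma state_payoff_single : single_agent state_payoff.
Proof. exact: card_unit. Qed.

(** Conditional independence applies because the weight [sigma] of an action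
depends on the signal of player 1, its payoff on that of player 2. *)
Lemma expected_state_payoff (sigma : S -> distr R (act1 g))
    (tau1 : T -> distr R (act2 state_payoff)) :
  expected_payoff u (g := state_payoff) sigma tau1 = expected_payoff u sigma tau.
Proof.
have bs i : bnd (fun x : K * S * T => sigma x.1.2 i).
  exact: (bnd_comp (fun x : K * S * T => x.1.2) (bnd_strategy sigma i)).
rewrite !expected_payoffE !expect_sum; last 2 first.
- by move=> i; apply: bndM => //; exact: bnd_reply.
- move=> i; apply: bndM; first exact: bs.
  exact: bnd_reply.
apply: eq_bigr => i _.
rewrite (@cond_indep_expect _ _ _ _ u u_ci (fun y => sigma y.2 i)
  (fun y => reply_payoff tau i y.1 y.2)).
- congr expect; apply/funext => x; congr (_ * _).
  by rewrite /reply_payoff -mulr_suml distr_sum1 mul1r.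
- exact: (bnd_comp (fun y : K * S => y.2) (bnd_strategy sigma i)).
- by exists 1 => y; exact: reply_payoff_bound.
Qed.

End SingleAgentReduction.

(** The witness is the single-agent problem against a nearly optimal strategy of
player 2 in [v].  Its conditional expectations are taken under [u]; payoffs
under [v] are payoffs under [u], so the same problem serves for both. *)
Lemma value_gap_single_agent (R : realType) (K : finType) (C C' D : countType)
    (u : info_structure R K (C * C')%type D) (g : payoff R K) (eps : R) :
  cond_indep u -> 0 < eps ->
  let v := push (@forget_c' K C C' D) u in
  exists2 h : payoff R K, single_agent h &
    game_value u g - game_value v g <= game_value u h - game_value v h + eps.
Proof.
move=> u_ci eps0 v; have e4 : 0 < eps / 4 by rewrite divr_gt0.
(* one quarter of [eps] for each of the four nearly optimal strategies *)
have [tau tauP] := value_opt2 v g e4.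
pose h := state_payoff u tau; exists h; first exact: state_payoff_single.
have [s sP] := value_opt1 u g e4.
have [t tP] := value_opt2 u h e4.
have [s' s'P] := value_opt1 v h e4.
have := sP tau; have := tP s; have := s'P t; have := tauP s'.
rewrite !expected_payoff_forget !(expected_state_payoff u_ci); lra.
Qed.

Unset Implicit Arguments.

Theorem corollary2 (R : realType) (K : finType) (C C' D : countType)
    (K_ge2 : (2 <= #|K|)%N)
    (C_neq0 : inhabited C) (C'_neq0 : inhabited C') (D_neq0 : inhabited D)
    (u : info_structure R K (C * C')%type D) (v : info_structure R K C D)
    (v_marg : v = push (@forget_c' K C C' D) u)
    (u_ci : cond_indep u) :
  value_dist u v = value_dist1 u v.
Proof.
rewrite v_marg {v v_marg}; set v := push _ _.
have gap_bound g : `|game_value u g - game_value v g| <= 2.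
  apply: le_trans (ler_normB _ _) _.
  by have := game_value_bound u g; have := game_value_bound v g; lra.
have gap_ge g : `|game_value u g - game_value v g| =
    game_value u g - game_value v g.
  by rewrite ger0_norm// subr_ge0 forget_value_le.
pose gaps (G : payoff R K -> Prop) :=
  [set x : R | exists2 g, G g & x = `|game_value u g - game_value v g|].
have gaps_ub G : has_ubound (gaps G) by exists 2 => _ [g _ ->].
have pay0 (k : K) (i j : unit) : -1 <= (0 : R) <= 1 by rewrite lerN10 ler01.
have unit0 : (0 < #|{: unit}|)%N by rewrite card_unit.
pose g0 := Payoff unit0 unit0 pay0.
have g0_single : single_agent g0 by exact: card_unit.
rewrite /value_dist /value_dist1 /value_dist_on -!/(gaps _).
apply/eqP; rewrite eq_le; apply/andP; split; last first.
  apply: ge_sup; first by exists `|game_value u g0 - game_value v g0|, g0.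
  by move=> _ [g _ ->]; apply: ub_le_sup => //; exists g.
apply: ge_sup; first by exists `|game_value u g0 - game_value v g0|, g0.
move=> _ [g _ ->]; rewrite gap_ge; apply/ler_addgt0Pr => eps eps0.
have [h h1] := value_gap_single_agent g u_ci eps0.
move=> /le_trans; apply; rewrite lerD2r -gap_ge.
by apply: ub_le_sup => //; exists h.
Qed.
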